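(* Let $E$ be an operator space which is not equal to the zero vector space. Then $E$ does not have the completely bounded column-row property.
   Context: An operator space $E$ is said to satisfy the completely bounded column-row property (completely bounded CRP) if there exists a constant $C>0$ such that for all $n\ge 1$ the map $M_{n,1}(E)\to M_{1,n}(E)$, $[x_1\ \dots\ x_n]^t\mapsto[x_1\ \dots\ x_n]$, has completely bounded norm $<C$. Here $M_{m,n}(E)$ carries its natural operator space structure, $M_N(M_{m,n}(E))=M_{Nm,Nn}(E)$, and the completely bounded norm of a linear map $u:X\to Y$ between operator spaces is $\|u\|_{cb}=\sup_{N\ge 1}\|id_{M_N}\otimes u\|_{M_N(X)\to M_N(Y)}$. *)

(* Defs.v *)
From HB Require Import structures.
From mathcomp Require Import all_boot all_order all_algebra.
From mathcomp Require Import all_classical all_reals all_analysis.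
From mathcomp Require Import complex.

Set Implicit Arguments.
Unset Strict Implicit.
Unset Printing Implicit Defensive.

Import Order.TTheory GRing.Theory Num.Theory.

Local Open Scope classical_set_scope.
Local Open Scope ring_scope.
Local Open Scope complex_scope.

Definition cmod (R : realType) (z : R[i]) : R := ComplexField.Normc.normc z.

Definition l2norm (R : realType) (n : nat) (v : 'cV[R[i]]_n) : R :=
  Num.sqrt (\sum_(i < n) cmod (v i 0) ^+ 2).

(* The norm of a as an operator from l2^n to l2^m. *)
Definition opnorm (R : realType) (m n : nat) (a : 'M[R[i]]_(m, n)) : R :=
  sup [set l2norm (a *m v) | v in [set v : 'cV[R[i]]_n | l2norm v <= 1]].

(* MathComp makes 'M[V]_(m, n) an lmodType only for matrices over a ring, so the
   scalar and bimodule actions on matrices over a module are spelled out. *)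
Definition scalev_mx (K : pzRingType) (V : lmodType K) (m n : nat)
    (c : K) (x : 'M[V]_(m, n)) : 'M[V]_(m, n) :=
  map_mx ( *:%R c) x.

Definition mul_cmx_vmx (K : pzRingType) (V : lmodType K) (m n p : nat)
    (a : 'M[K]_(m, n)) (x : 'M[V]_(n, p)) : 'M[V]_(m, p) :=
  \matrix_(i < m, j < p) \sum_(k < n) a i k *: x k j.

Definition mul_vmx_cmx (K : comPzRingType) (V : lmodType K) (m n p : nat)
    (x : 'M[V]_(m, n)) (b : 'M[K]_(n, p)) : 'M[V]_(m, p) :=
  \matrix_(i < m, j < p) \sum_(k < n) b k j *: x i k.

Definition matrix_norms (R : realType) (X : zmodType) : Type :=
  forall N : nat, 'M[X]_N -> R.

(* Abstract operator spaces: norms on all the M_n(E) subject to Ruan's axioms.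
   The size n = 0 carries no information: M_0(E) = 0 has norm 0. *)
Record is_operator_space (R : realType) (E : lmodType R[i])
    (nrm : matrix_norms R E) : Prop := IsOperatorSpace {
  mxnorm_eq0 : forall n (x : 'M[E]_n), nrm n x = 0 -> x = 0;
  mxnormD : forall n (x y : 'M[E]_n), nrm n (x + y) <= nrm n x + nrm n y;
  mxnormZ : forall n (c : R[i]) (x : 'M[E]_n),
    nrm n (scalev_mx c x) = cmod c * nrm n x;
  mxnorm_dsum : forall m n (x : 'M[E]_m) (y : 'M[E]_n),
    nrm (m + n)%N (block_mx x 0 0 y) = Num.max (nrm m x) (nrm n y);
  mxnorm_bimod : forall m n
      (a : 'M[R[i]]_(m, n)) (x : 'M[E]_n) (b : 'M[R[i]]_(n, m)),
    nrm m (mul_vmx_cmx (mul_cmx_vmx a x) b) <= opnorm a * nrm n x * opnorm b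
}.

(* M_{m,n}(E) sits in M_p(E), p = max(m, n), as the upper left corner. *)
Definition pad_mx (V : zmodType) (m n : nat) (x : 'M[V]_(m, n)) :
    'M[V]_(maxn m n) :=
  \matrix_(i < maxn m n, j < maxn m n)
    match insub (val i) : option 'I_m, insub (val j) : option 'I_n with
    | Some i', Some j' => x i' j'
    | _, _ => 0
    end.

Definition rect_norm (R : realType) (E : zmodType) (nrm : matrix_norms R E)
    (m n : nat) (x : 'M[E]_(m, n)) : R :=
  nrm (maxn m n) (pad_mx x).

(* The operator space structure of M_{m,n}(E): an N x N matrix of m x n blocks
   is read as an element of M_{Nm,Nn}(E). *)
Definition rect_matrix_norms (R : realType) (E : zmodType)
    (nrm : matrix_norms R E) (m n : nat) : matrix_norms R 'M[E]_(m, n) :=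
  fun N x => rect_norm nrm (\mxblock_(i < N, j < N) x i j).

Definition ampl_norm (R : realType) (X Y : zmodType)
    (nX : matrix_norms R X) (nY : matrix_norms R Y) (u : X -> Y) (N : nat) :
    \bar R :=
  ereal_sup [set (nY N (map_mx u x))%:E | x in [set x : 'M[X]_N | nX N x <= 1]].

Definition cb_norm (R : realType) (X Y : zmodType)
    (nX : matrix_norms R X) (nY : matrix_norms R Y) (u : X -> Y) : \bar R :=
  ereal_sup [set ampl_norm nX nY u N | N in [set N : nat | (1 <= N)%N]].

Definition col_to_row (E : zmodType) (n : nat) (x : 'M[E]_(n, 1)) :
    'M[E]_(1, n) := x^T.

Definition cb_column_row_property (R : realType) (E : zmodType)
    (nrm : matrix_norms R E) : Prop :=
  exists C : R, 0 < C /\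
    forall n : nat, (1 <= n)%N ->
      (cb_norm (rect_matrix_norms nrm (m := n) (n := 1))
               (rect_matrix_norms nrm (m := 1) (n := n))
               (@col_to_row E n) < C%:E)%E.

(* Main.v *)
(** Fix x in E with norm 1 and test the N-th amplification, N = n, on the
    column with k-th entry e_{1k} (x) x. As a column it is V (x) x for an
    isometry V, so it has norm at most 1. As a row it has norm at least
    sqrt n: compressing it on the left to the first coordinate and multiplying
    it on the right by the vector sum_k e_k (x) e_k, which has norm sqrt n,
    gives n x. Hence the cb norms are at least sqrt n. *)

Require Import Defs.
From mathcomp Require Import all_boot all_order all_algebra.
From mathcomp Require Import all_classical all_reals all_analysis.
From mathcomp Require Import complex.

Import Order.TTheory GRing.Theory Num.Theory.
Local Open Scope ring_scope.
Local Open Scope complex_scope.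

(** * Bounds for scalar matrices acting between finite-dimensional l2 spaces *)

Section OperatorNorm.
Context {R : realType}.
Implicit Types (c d : R).

Lemma cmod0 : cmod (0 : R[i]) = 0.
Proof. exact: ComplexField.Normc.normc0. Qed.

Lemma l2norm_sum_ge0 n (v : 'cV[R[i]]_n) : 0 <= \sum_(i < n) cmod (v i 0) ^+ 2.
Proof. by apply: sumr_ge0 => i _; exact: sqr_ge0. Qed.

Lemma l2norm0 n : l2norm (0 : 'cV[R[i]]_n) = 0.
Proof.
rewrite /l2norm big1 ?sqrtr0 // => i _.
by rewrite mxE cmod0 expr0n.
Qed.

(** [opnorm] is a real [sup], informative only when the set is bounded above. An explicit bound
    composes without a separate proof that the supremum is finite. *)
Definition op_bounded c {m n} (a : 'M[R[i]]_(m, n)) : Prop :=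
  forall v : 'cV[R[i]]_n, l2norm (a *m v) <= c * l2norm v.

Lemma op_boundedM {c d m n p} {a : 'M[R[i]]_(m, n)} {b : 'M[R[i]]_(n, p)} :
  0 <= c -> op_bounded c a -> op_bounded d b ->
  op_bounded (c * d) (a *m b).
Proof.
move=> c0 ha hb v; rewrite -mulmxA (le_trans (ha _)) // -mulrA.
exact: ler_wpM2l.
Qed.

Lemma opnorm_ge0 m n (a : 'M[R[i]]_(m, n)) : 0 <= opnorm a.
Proof.
rewrite /opnorm.
set S := (X in sup X).
have S0 : S 0 by exists 0; [rewrite /= l2norm0|rewrite mulmx0 l2norm0].
(* When no supremum exists, [sup] takes the default value 0. *)
case: (pselect (has_sup S)) => [[_ ub]|/sup_out ->//].
exact: (ub_le_sup ub).
Qed.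

Lemma opnorm_le c m n (a : 'M[R[i]]_(m, n)) :
  0 <= c -> op_bounded c a -> opnorm a <= c.
Proof.
move=> c0 ha; apply: ge_sup.
  by exists 0; exists 0; [rewrite /= l2norm0|rewrite mulmx0 l2norm0].
move=> _ [v /= v1 <-]; apply: (le_trans (ha v)).
by rewrite -[leRHS]mulr1 ler_wpM2l.
Qed.

(** The product with v keeps the coordinates at the positions [f i]; by injectivity they are
    distinct terms of the squared norm of v. *)
Lemma rowsub1_bounded {m n} {f : 'I_m -> 'I_n} :
  injective f -> op_bounded 1 (rowsub f (1%:M : 'M[R[i]]_n)).
Proof.
move=> f_inj v; rewrite -rowsubE mul1r ler_sqrt ?l2norm_sum_ge0 //.
under eq_bigr do rewrite mxE.
pose F p := cmod (v p 0) ^+ 2.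
have -> : \sum_(i < m) cmod (v (f i) 0) ^+ 2 =
    \sum_(p in [set f i | i in 'I_m]) F p.
  by rewrite big_imset //= => i j _ _; exact: f_inj.
rewrite [leRHS](bigID (mem [set f i | i in 'I_m])) /= lerDl.
by apply: sumr_ge0 => i _; exact: sqr_ge0.
Qed.

(** The matrix moves coordinate k to position [f k] and puts zeros elsewhere. Each fibre of [f] has
    at most one point, so regrouping the squared norm along the fibres shows an isometry. *)
Lemma colsub1_bounded {m n} {f : 'I_m -> 'I_n} :
  injective f -> op_bounded 1 (colsub f (1%:M : 'M[R[i]]_n)).
Proof.
move=> f_inj v; rewrite mul1r ler_sqrt ?l2norm_sum_ge0 //.
have entry p : cmod ((colsub f 1%:M *m v) p 0) ^+ 2 =
    \sum_(k < m | f k == p) cmod (v k 0) ^+ 2.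
  rewrite mxE; under eq_bigr do rewrite !mxE.
  case: (pickP (fun k => f k == p)) => [k /eqP <-|no].
    rewrite (bigD1 k) //= eqxx mul1r big1 ?addr0; last first.
      by move=> j; rewrite -(inj_eq f_inj) eq_sym => /negbTE ->; rewrite mul0r.
    by rewrite (big_pred1 k) // => j; rewrite /= (inj_eq f_inj).
  rewrite big1 => [|j _]; last by rewrite eq_sym no mul0r.
  by rewrite cmod0 expr0n big_pred0.
rewrite (eq_bigr _ (fun p _ => entry p)).
by rewrite [leRHS](partition_big f predT).
Qed.

Lemma const_mx1_bounded n :
  op_bounded (Num.sqrt n%:R) (const_mx 1 : 'M[R[i]]_(n, 1)).
Proof.
move=> v; rewrite /l2norm big_ord1 -sqrtrM ?ler0n //.
rewrite (eq_bigr (fun=> cmod (v 0 0) ^+ 2)) ?sumr_const ?card_ord ?mulr_natl //.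
by move=> i _; rewrite mxE big_ord1 mxE mul1r.
Qed.

End OperatorNorm.

(** * Elementary tensors of a scalar matrix and a vector *)

Definition tensor_mx {K : pzRingType} {V : lmodType K} {m n : nat}
    (a : 'M[K]_(m, n)) (x : V) : 'M[V]_(m, n) :=
  map_mx (fun c => c *: x) a.

Lemma mul_cmx_tensor (K : pzRingType) (V : lmodType K) m n p
    (a : 'M[K]_(m, n)) (b : 'M[K]_(n, p)) (x : V) :
  mul_cmx_vmx a (tensor_mx b x) = tensor_mx (a *m b) x.
Proof.
apply/matrixP => i j; rewrite !mxE scaler_suml.
by apply: eq_bigr => k _; rewrite !mxE scalerA.
Qed.

Lemma mul_tensor_cmx (K : comPzRingType) (V : lmodType K) m n p
    (a : 'M[K]_(m, n)) (b : 'M[K]_(n, p)) (x : V) :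
  mul_vmx_cmx (tensor_mx a x) b = tensor_mx (a *m b) x.
Proof.
apply/matrixP => i j; rewrite !mxE scaler_suml.
by apply: eq_bigr => k _; rewrite !mxE scalerA mulrC.
Qed.

(** Padding is a coordinate inclusion on the left and a coordinate projection on the right, so norms
    of padded tensors can be estimated through scalar factors. *)
Lemma pad_tensor (K : pzRingType) (V : lmodType K) m n
    (a : 'M[K]_(m, n)) (x : V) :
  pad_mx (tensor_mx a x) =
  tensor_mx (colsub (widen_ord (leq_maxl m n)) 1%:M *m a
               *m rowsub (widen_ord (leq_maxr m n)) 1%:M) x.
Proof.
apply/matrixP => p q; rewrite !mxE.
have left_entry k : (colsub (widen_ord (leq_maxl m n)) 1%:M *m a) p k =
    if insub (val p) is Some i then a i k else 0.
  rewrite mxE; case: insubP => [i _ ip|/negP pm].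
    rewrite (bigD1 i) //= !mxE -val_eqE /= -ip eqxx mul1r big1 ?addr0 // => j.
    by rewrite !mxE -!val_eqE /= -ip eq_sym => /negbTE ->; rewrite mul0r.
  rewrite big1 // => j _; rewrite !mxE -val_eqE /=.
  by case: eqP => [e|]; rewrite ?mul0r //; case: pm; rewrite /= e ltn_ord.
under eq_bigr do rewrite left_entry !mxE -val_eqE /=.
case: (insubP _ (val p)) => [i _ _|_]; last first.
  by rewrite big1 ?scale0r // => j _; rewrite mul0r.
case: insubP => [j _ jq|/negP qn].
  rewrite (bigD1 j) //= -jq eqxx mulr1 big1 ?addr0 ?mxE // => k.
  by rewrite -val_eqE /= => /negbTE ->; rewrite mulr0.
rewrite big1 ?scale0r // => j _.
by case: eqP => [e|]; rewrite ?mulr0 //; case: qn; rewrite /= -e ltn_ord.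
Qed.

Lemma mxblock_tensor (K : pzRingType) (V : lmodType K) N m n
    (a : 'I_N -> 'I_N -> 'M[K]_(m, n)) (x : V) :
  \mxblock_(i < N, j < N) tensor_mx (a i j) x =
  tensor_mx (\mxblock_(i < N, j < N) a i j) x.
Proof. by apply/matrixP => p q; rewrite !mxE. Qed.

Lemma widen_ord_inj m n (le_mn : (m <= n)%N) : injective (widen_ord le_mn).
Proof. by move=> i j /(congr1 (@nat_of_ord n)) /= /val_inj. Qed.

(** * Norms of elementary tensors in an operator space *)

Section OperatorSpace.
Context {R : realType} {E : lmodType R[i]} {nrm : matrix_norms R E}.
Hypothesis E_op : is_operator_space nrm.

Lemma mxnorm0 n : nrm n 0 = 0.
Proof.
have <- : scalev_mx 0 (0 : 'M[E]_n) = 0.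
  by apply/matrixP => i j; rewrite !mxE scale0r.
by rewrite (mxnormZ E_op) cmod0 mul0r.
Qed.

(** The triangle inequality for x and -x, which have equal norms, gives 0 <= 2 [nrm n x]. *)
Lemma mxnorm_ge0 n (x : 'M[E]_n) : 0 <= nrm n x.
Proof.
have nrmN : nrm n (- x) = nrm n x.
  have -> : - x = scalev_mx (-1) x by apply/matrixP => i j; rewrite !mxE scaleN1r.
  by rewrite (mxnormZ E_op) /cmod normcN ComplexField.Normc.normc1 mul1r.
have := mxnormD E_op x (- x); rewrite subrr mxnorm0 nrmN -mulr2n.
by rewrite pmulrn_lge0.
Qed.

Lemma mxnorm_tensor_le {c d : R} {m n} (a : 'M[R[i]]_(m, n))
    (w : 'M[R[i]]_n) (b : 'M[R[i]]_(n, m)) (x : E) :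
  0 <= c -> 0 <= d -> op_bounded c a -> op_bounded d b ->
  nrm m (tensor_mx (a *m w *m b) x) <= c * nrm n (tensor_mx w x) * d.
Proof.
move=> c0 d0 ha hb; rewrite -mul_tensor_cmx -mul_cmx_tensor.
apply: (le_trans (mxnorm_bimod E_op _ _ _)).
apply: ler_pM; rewrite ?mulr_ge0 ?opnorm_ge0 ?mxnorm_ge0 //.
  by rewrite ler_wpM2r ?mxnorm_ge0 ?opnorm_le.
exact: opnorm_le.
Qed.

(** Induction on n: splitting off one diagonal entry makes the norm a maximum by [mxnorm_dsum].
    Equality may fail at n = 0, where the norm is 0. *)
Lemma mxnorm_tensor1 n (x : E) :
  nrm n (tensor_mx 1%:M x) <= nrm 1%N (tensor_mx 1%:M x).
Proof.
elim: n => [|n IH].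
  have -> : tensor_mx 1%:M x = 0 :> 'M[E]_0 by apply/matrixP => [[]].
  by rewrite mxnorm0 mxnorm_ge0.
have -> : tensor_mx 1%:M x = block_mx (tensor_mx 1%:M x) 0 0 (tensor_mx 1%:M x)
    :> 'M[E]_(1 + n).
  have t0 m p : (0 : 'M[E]_(m, p)) = tensor_mx 0 x.
    by apply/matrixP => i j; rewrite !mxE scale0r.
  by rewrite !t0 -map_block_mx -scalar_mx_block.
by rewrite [leLHS](@mxnorm_dsum _ _ _ E_op 1 n) ge_max lexx.
Qed.

(** The tensor factors through [tensor_mx 1%:M x] of size k with contractions on both sides, so the
    bound is independent of k. *)
Lemma rect_norm_le m n k (a : 'M[R[i]]_(m, k)) (b : 'M[R[i]]_(k, n)) (x : E) :
  op_bounded 1 a -> op_bounded 1 b ->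
  rect_norm nrm (tensor_mx (a *m b) x) <= nrm 1%N (tensor_mx 1%:M x).
Proof.
move=> ha hb; rewrite /rect_norm pad_tensor.
set U := colsub _ _; set W := rowsub _ _.
have -> : U *m (a *m b) *m W = U *m a *m 1%:M *m (b *m W).
  by rewrite mulmx1 !mulmxA.
have hU : op_bounded 1 U.
  by apply: colsub1_bounded; exact: widen_ord_inj.
have hW : op_bounded 1 W.
  by apply: rowsub1_bounded; exact: widen_ord_inj.
have hl := op_boundedM ler01 hU ha.
have hr := op_boundedM ler01 hb hW.
rewrite !mulr1 in hl hr.
apply: (le_trans (mxnorm_tensor_le _ _ _ _ ler01 ler01 hl hr)).
by rewrite mul1r mulr1 mxnorm_tensor1.
Qed.

(** Padding is undone by the left inverse of the row inclusion and the right inverse of the column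
    projection, both contractions; these are absorbed into [a] and [b]. *)
Lemma rect_norm_ge {c d : R} {m n k} {a : 'M[R[i]]_(k, m)} (y : 'M[R[i]]_(m, n))
    {b : 'M[R[i]]_(n, k)} (x : E) :
  0 <= c -> 0 <= d -> op_bounded c a -> op_bounded d b ->
  nrm k (tensor_mx (a *m y *m b) x) <= c * rect_norm nrm (tensor_mx y x) * d.
Proof.
move=> c0 d0 ha hb; rewrite /rect_norm pad_tensor.
set f := widen_ord _; set g := widen_ord _.
have f_inj : injective f by exact: widen_ord_inj.
have g_inj : injective g by exact: widen_ord_inj.
have sub1 p q (h : 'I_p -> 'I_q) : injective h ->
    rowsub h 1%:M *m colsub h 1%:M = 1%:M :> 'M[R[i]]_p.
  move=> h_inj; rewrite -mxsub_mul mulmx1; apply/matrixP => i j.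
  by rewrite !mxE (inj_eq h_inj).
have -> : a *m y *m b = a *m rowsub f 1%:M
    *m (colsub f 1%:M *m y *m rowsub g 1%:M) *m (colsub g 1%:M *m b).
  rewrite !mulmxA -[in RHS](mulmxA a) sub1 // mulmx1.
  by rewrite -[in RHS](mulmxA (a *m y)) sub1 // mulmx1.
have hl := op_boundedM c0 ha (rowsub1_bounded f_inj).
have hr := op_boundedM ler01 (colsub1_bounded g_inj) hb.
rewrite mulr1 in hl; rewrite mul1r in hr.
exact: mxnorm_tensor_le.
Qed.

Lemma exists_norm1 : (exists x : E, x <> 0) ->
  exists x : E, nrm 1%N (tensor_mx 1%:M x) = 1.
Proof.
case=> x x0; set r := nrm 1%N (tensor_mx 1%:M x).
have r0 : r != 0.
  apply/eqP => /(mxnorm_eq0 E_op)/matrixP/(_ 0 0).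
  by rewrite !mxE eqxx scale1r.
exists ((r^-1)%:C *: x).
have -> : tensor_mx 1%:M ((r^-1)%:C *: x) =
    scalev_mx (r^-1)%:C (tensor_mx 1%:M x) :> 'M[E]_1.
  by apply/matrixP => i j; rewrite !mxE !scalerA mulrC.
rewrite (mxnormZ E_op) -/r /cmod /= expr0n addr0 sqrtr_sqr ger0_norm ?mulVf //.
by rewrite invr_ge0 mxnorm_ge0.
Qed.

End OperatorSpace.

(** * The test column, its transpose, and the contradiction *)

Lemma Rank_const_inj N m (f : 'I_N -> 'I_m) :
  injective (fun k : 'I_N => @tagnat.Rank N (fun=> m) k (f k)).
Proof. by move=> i j /(congr1 tagnat.sig1); rewrite !tagnat.Rank1K. Qed.

(** This regroups the column with k-th entry e_{1k} as a matrix of columns: entry (i, j) has k-th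
    coordinate (e_{1k})_{ij}, hence is e_j in the top row and 0 below. *)
Definition top_delta (K : pzRingType) (n : nat) (i j : 'I_n.+1) :
    'M[K]_(n.+1, 1) :=
  if i == ord0 then delta_mx j ord0 else 0.

Lemma Rank_eqE N m (p : 'I_(\sum_(i < N) m)) (i : 'I_N) (k : 'I_m) :
  (p == @tagnat.Rank N (fun=> m) i k) =
  (tagnat.sig1 p == i) && (tagnat.sig2 p == k :> 'I_m).
Proof. by rewrite -[in LHS](tagnat.sig2K p) -val_eqE tagnat.eq_Rank. Qed.

(** The top block row is the identity and the others vanish. The first factor includes it as block
    0; the second identifies the blocks of width 1 with single coordinates. *)
Lemma top_delta_col (K : pzRingType) n :
  \mxblock_(i < n.+1, j < n.+1) top_delta K n i j =
  colsub (@tagnat.Rank _ (fun=> n.+1) ord0) 1%:M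
    *m rowsub (fun k => @tagnat.Rank n.+1 (fun=> 1%N) k ord0) 1%:M.
Proof.
(* Only the index k of the block containing q contributes to the product. *)
apply/matrixP => p q; rewrite !mxE (bigD1 (tagnat.sig1 q)) //=.
rewrite [X in _ + X]big1 => [|k kq]; last first.
  rewrite !mxE [_ == q]eq_sym !Rank_eqE [tagnat.sig1 q == _]eq_sym.
  by rewrite (negbTE kq) mulr0.
rewrite !mxE [_ == q]eq_sym !Rank_eqE eqxx /=.
rewrite [tagnat.sig2 q]ord1 eqxx mulr1 addr0.
by rewrite /top_delta; case: eqP => _; rewrite !mxE //= andbT.
Qed.

Theorem proposition3p3 (R : realType) (E : lmodType R[i])
    (nrm : matrix_norms R E) (E_operator_space : is_operator_space nrm)
    (E_neq0 : exists x : E, x <> 0) :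
  ~ cb_column_row_property nrm.
Proof.
case=> C [C0 hC]; have [x x1] := exists_norm1 E_operator_space E_neq0.
(* Then C^2 < n, whereas the test at size [n.+1] will force n + 1 < C^2. *)
pose n := Num.Def.archi_bound (C ^+ 2).
pose X := \matrix_(i < n.+1, j < n.+1) tensor_mx (top_delta R[i] n i j) x.
pose Y := rect_matrix_norms nrm (m := 1) (n := n.+1) (N := n.+1)
  (map_mx (@col_to_row E n.+1) X).
have X1 : rect_matrix_norms nrm (m := n.+1) (n := 1) X <= 1.
  rewrite /rect_matrix_norms.
  have -> : \mxblock_(i < n.+1, j < n.+1) X i j =
      \mxblock_(i < n.+1, j < n.+1) tensor_mx (top_delta R[i] n i j) x.
    by apply: eq_mxblock => i j; rewrite mxE.
  rewrite mxblock_tensor top_delta_col -x1.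
  apply: rect_norm_le => //.
    apply: colsub1_bounded => i j /(congr1 val)/eqP.
    by rewrite tagnat.eq_Rank eqxx => /eqP/val_inj.
  exact/rowsub1_bounded/(@Rank_const_inj _ 1 (fun=> ord0)).
have YC : Y < C.
  rewrite -lte_fin; apply: le_lt_trans (hC n.+1 isT).
  apply: (@le_trans _ _ (ampl_norm (rect_matrix_norms nrm (m := n.+1) (n := 1))
    (rect_matrix_norms nrm (m := 1) (n := n.+1)) (@col_to_row E n.+1) n.+1)).
    by apply: ereal_sup_ubound; exists X.
  by apply: ereal_sup_ubound; exists n.+1.
have nY : n.+1%:R <= Y * Num.sqrt n.+1%:R.
  pose row_blocks := \mxblock_(i < n.+1, j < n.+1) (top_delta R[i] n i j)^T.
  have -> : Y = rect_norm nrm (tensor_mx row_blocks x).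
    rewrite /Y /rect_matrix_norms -mxblock_tensor; congr rect_norm.
    by apply: eq_mxblock => i j; rewrite !mxE /col_to_row /tensor_mx map_trmx.
  (* [a] selects the top row, where the vectors e_k^t stand side by side. *)
  pose a : 'M[R[i]]_(1, _) :=
    rowsub (fun=> @tagnat.Rank n.+1 (fun=> 1%N) ord0 ord0) 1%:M.
  (* [b] is the sum of the e_k (x) e_k, written as an isometry applied to the all-ones vector. *)
  pose b : 'M[R[i]]_(_, 1) :=
    colsub (fun k => @tagnat.Rank n.+1 (fun=> n.+1) k k) 1%:M *m const_mx 1.
  have ha : op_bounded 1 a by apply: rowsub1_bounded => i j _; rewrite !ord1.
  have hb : op_bounded (Num.sqrt n.+1%:R) b.
    rewrite -[Num.sqrt _]mul1r; apply: op_boundedM => //.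
      exact/colsub1_bounded/Rank_const_inj.
    exact: const_mx1_bounded.
  (* Each block k contributes 1, the k-th coordinate of e_k. *)
  have ab : a *m row_blocks *m b = n.+1%:R *: 1%:M.
    rewrite mulmxA -rowsubE mulmx_colsub mulmx1.
    apply/matrixP => i j; rewrite !ord1 !mxE (eq_bigr (fun=> 1)).
      by rewrite sumr_const card_ord mulr1.
    move=> k _; rewrite !mxE mulr1 !tagnat.Rank1K /top_delta eqxx !mxE.
    by rewrite -!val_eqE /= !tagnat.Rank2K /= eqxx.
  have := rect_norm_ge E_operator_space row_blocks x ler01 (sqrtr_ge0 _) ha hb.
  rewrite ab mul1r; apply: le_trans.
  have -> : tensor_mx (n.+1%:R *: 1%:M) x =
      scalev_mx n.+1%:R (tensor_mx 1%:M x) :> 'M[E]_1.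
    by apply/matrixP => i j; rewrite !mxE scalerA.
  rewrite (mxnormZ E_operator_space) x1 mulr1 /cmod normcMn.
  by rewrite ComplexField.Normc.normc1.
have sY : Num.sqrt n.+1%:R <= Y.
  rewrite -(ler_pM2r (x := Num.sqrt n.+1%:R)) ?sqrtr_gt0 ?ltr0n //.
  by rewrite -expr2 sqr_sqrtr ?ler0n.
have nC : n.+1%:R < C ^+ 2.
  rewrite -[ltLHS]sqr_sqrtr ?ler0n // ltr_pXn2r ?nnegrE ?sqrtr_ge0 ?ltW //.
  exact: le_lt_trans YC.
have := lt_trans nC (archi_boundP (sqr_ge0 C)).
by rewrite ltr_nat ltnNge leqnSn.
Qed.
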